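(* Let $M$ be a complete pointed metric space. If $M$ is Lip-lin injective, then $M$ is purely 1-unrectifiable.
   Context: A metric space $M$ is purely 1-unrectifiable if there is no set $A\subset\mathbb R$ of positive Lebesgue measure that bi-Lipschitz embeds into $M$. A map $f\colon A\to M$ is bi-Lipschitz if there are $a,b>0$ with $a\,d(x,y)\le d(f(x),f(y))\le b\,d(x,y)$ for all $x,y$. A pointed metric space is a metric space with a distinguished base point $0$. $\mathrm{Lip}_0(M,N)$ is the set of Lipschitz maps $f\colon M\to N$ with $f(0)=0$; $\mathrm{Lip}_0(M)=\mathrm{Lip}_0(M,\mathbb R)$ is a Banach space for the norm $\|f\|_L$ = best Lipschitz constant of $f$. For $x\in M$, $\delta(x)\in \mathrm{Lip}_0(M)^*$ is the evaluation $\langle f,\delta(x)\rangle=f(x)$. The Lipschitz-free space $\mathcal F(M)$ is the norm-closed linear span of $\{\delta(x):x\in M\}$ in $\mathrm{Lip}_0(M)^*$. For $f\in \mathrm{Lip}_0(M,N)$, $\widehat f\colon \mathcal F(M)\to\mathcal F(N)$ is the unique bounded linear operator with $\widehat f(\delta(x))=\delta(f(x))$ for all $x\in M$. A complete pointed metric space $M$ is Lip-lin injective if for every complete pointed metric space $N$ and every injective $f\in \mathrm{Lip}_0(M,N)$, the operator $\widehat f$ is injective. *)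

(* Defs.v *)
From HB Require Import structures.
From mathcomp Require Import all_boot all_order all_algebra.
From mathcomp Require Import all_classical all_reals all_analysis.
Import Order.TTheory GRing.Theory Num.Theory.
Import numFieldNormedType.Exports.

Set Implicit Arguments.
Unset Strict Implicit.
Unset Printing Implicit Defensive.

Local Open Scope classical_set_scope.
Local Open Scope ring_scope.

(* The base point is [point]; [Complete] already extends [isPointed]. *)
#[short(type="pointedMetricType")]
HB.structure Definition PointedMetric (R : numDomainType) :=
  {M of Metric R M & isPointed M}.

#[short(type="completePointedMetricType")]
HB.structure Definition CompletePointedMetric (R : numDomainType) :=
  {M of Metric R M & Complete M}.

(* The line, with [mdist x y = `|y - x|] and base point [0]. *)
HB.instance Definition _ (R : numFieldType) := Metric.on R^o.

Section lipschitz_maps.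
Context {R : realType}.

Definition lipschitz_consts (M N : metricType R) (f : M -> N) : set R :=
  [set L | 0 <= L /\ forall x y, mdist (f x) (f y) <= L * mdist x y].

Definition best_lipschitz_const (M N : metricType R) (f : M -> N) : R :=
  inf (lipschitz_consts f).

Definition lip0 (M N : pointedMetricType R) : {pred M -> N} :=
  mem [set f : M -> N | lipschitz_consts f !=set0 /\ f point = point].

End lipschitz_maps.
Arguments lip0 {R} M N.

(* Lip_0(M, N); Lip_0(M) is [Lip0 M R^o]. *)
Record Lip0 (R : realType) (M N : pointedMetricType R) := MkLip0 {
  Lip0_fun :> M -> N;
  _ : Lip0_fun \in lip0 M N }.

HB.instance Definition _ (R : realType) (M N : pointedMetricType R) :=
  [isSub for @Lip0_fun R M N].
HB.instance Definition _ (R : realType) (M N : pointedMetricType R) :=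
  [Choice of Lip0 M N by <:].

Section Lip0_theory.
Context {R : realType}.
Implicit Types M N P : pointedMetricType R.

Lemma best_lipschitz_constP (M N : metricType R) (f : M -> N) :
  lipschitz_consts f !=set0 -> lipschitz_consts f (best_lipschitz_const f).
Proof.
move=> f0; split; first by apply: lb_le_inf => // L [].
move=> x y; have [->|xy] := eqVneq x y; first by rewrite !mdistxx mulr0.
have d0 : 0 < mdist x y by rewrite mdist_gt0.
rewrite -ler_pdivrMr//; apply: lb_le_inf => // L [_ fL].
by rewrite ler_pdivrMr.
Qed.

Lemma best_lipschitz_const_le (M N : metricType R) (f : M -> N) L :
  lipschitz_consts f L -> best_lipschitz_const f <= L.
Proof. by move=> fL; apply: ge_inf => //; exists 0 => K []. Qed.

Lemma Lip0P M N (f : Lip0 M N) :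
  lipschitz_consts f !=set0 /\ f point = point.
Proof. by case: f => f /= /[!inE]. Qed.

Lemma Lip0_comp_subproof M N P (f : Lip0 M N) (g : Lip0 N P) :
  g \o f \in lip0 M P.
Proof.
have [[K [K0 fK]] f0] := Lip0P f; have [[L [L0 gL]] g0] := Lip0P g.
rewrite inE; split; last by rewrite /= f0.
exists (L * K); split; first exact: mulr_ge0.
by move=> x y; rewrite (le_trans (gL _ _))// -mulrA ler_wpM2l.
Qed.

Definition Lip0_comp M N P (f : Lip0 M N) (g : Lip0 N P) : Lip0 M P :=
  MkLip0 (Lip0_comp_subproof f g).

Lemma lip0_submod_closed M : submod_closed (lip0 M R^o).
Proof.
split.
  rewrite inE; split => //; exists 0; split => // x y.
  by rewrite mdistxx mul0r.
move=> a f g /[!inE] -[[K [K0 fK]] f0] [[L [L0 gL]] g0].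
split.
  exists (`|a| * K + L); split; first by rewrite addr_ge0// mulr_ge0.
  move=> x y; rewrite /mdist/= -!/(mdist _ _) !fctE opprD addrACA -scalerBr.
  rewrite (le_trans (ler_normD _ _))// mulrDl lerD//; last exact: gL.
  by rewrite normrM -mulrA ler_wpM2l//; exact: fK.
by rewrite !fctE f0 g0 scaler0 addr0.
Qed.

HB.instance Definition _ M :=
  GRing.isSubmodClosed.Build R (M -> R^o) (lip0 M R^o) (lip0_submod_closed M).

End Lip0_theory.

HB.instance Definition _ (R : realType) (M : pointedMetricType R) :=
  [SubChoice_isSubLmodule of Lip0 M R^o by <:].

Section Lip0_norm.
Context {R : realType} {M : pointedMetricType R}.
Implicit Types f g : Lip0 M R^o.

Let nm f := best_lipschitz_const f.

Let nmP f : lipschitz_consts f (nm f).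
Proof. by apply: best_lipschitz_constP; case: (Lip0P f). Qed.

Let nmD f g : nm (f + g) <= nm f + nm g.
Proof.
apply: best_lipschitz_const_le; have [[f0 fL] [g0 gL]] := (nmP f, nmP g).
split=> [|x y]; first exact: addr_ge0.
rewrite mulrDl (le_trans _ (lerD (fL x y) (gL x y)))//.
by rewrite /mdist/= opprD addrACA ler_normD.
Qed.

Let nmZ_le (a : R) f : nm (a *: f) <= `|a| * nm f.
Proof.
apply: best_lipschitz_const_le; have [f0 fL] := nmP f.
split=> [|x y]; first exact: mulr_ge0.
rewrite -mulrA (le_trans _ (ler_wpM2l (normr_ge0 a) (fL x y)))//.
by rewrite /mdist/= -normrM -mulrBr.
Qed.

Let nmZ (a : R) f : nm (a *: f) = `|a| * nm f.
Proof.
apply/eqP; rewrite eq_le nmZ_le/=.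
have [->|a0] := eqVneq a 0; first by rewrite normr0 mul0r; case: (nmP (0 *: f)).
rewrite -ler_pdivlMl ?normr_gt0// -normfV.
by rewrite -[leLHS]/(nm f) -{1}[f](scalerK a0) nmZ_le.
Qed.

Let nm0_eq0 f : nm f = 0 -> f = 0.
Proof.
move=> f0; apply/val_inj/funext => x /=.
have [_ /(_ point x)] := nmP f; rewrite f0 mul0r.
have [_ ->] := Lip0P f.
by rewrite /mdist/= subr0 normr_le0 => /eqP.
Qed.

HB.instance Definition _ := Lmodule_isNormed.Build R (Lip0 M R^o) nmD nmZ nm0_eq0.

Lemma Lip0_normE f : `|f| = best_lipschitz_const f.
Proof. by []. Qed.

End Lip0_norm.

Section dual.
Context {R : realType}.

Definition continuous_functional (V : normedModType R) : {pred V -> R^o} :=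
  mem [set phi : V -> R^o | linear phi /\ continuous phi].

End dual.
Arguments continuous_functional {R} V.

Record dual (R : realType) (V : normedModType R) := MkDual {
  dual_fun :> V -> R^o;
  _ : dual_fun \in continuous_functional V }.

HB.instance Definition _ (R : realType) (V : normedModType R) :=
  [isSub for @dual_fun R V].
HB.instance Definition _ (R : realType) (V : normedModType R) :=
  [Choice of dual V by <:].

Section dual_submod.
Context {R : realType}.
Implicit Types V : normedModType R.

Lemma dual_submod_closed V : submod_closed (continuous_functional V).
Proof.
split.
  by rewrite inE; split; [move=> a u v; rewrite -![0 _]/(0 : R^o) scaler0 addr0
    | exact: cst_continuous].
move=> a f g /[!inE] -[lf cf] [lg cg]; split.
  move=> b u v; rewrite !fctE lf lg !scalerDr addrACA; congr (_ + _).
  by rewrite !scalerA mulrC.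
by move=> x; apply: cvgD; [apply: cvgZr; exact: cf|exact: cg].
Qed.

HB.instance Definition _ V :=
  GRing.isSubmodClosed.Build R (V -> R^o) (continuous_functional V)
    (@dual_submod_closed V).

End dual_submod.

HB.instance Definition _ (R : realType) (V : normedModType R) :=
  [SubChoice_isSubLmodule of dual V by <:].

Section dual_norm.
Context {R : realType}.
Implicit Types V : normedModType R.

Lemma dualP V (phi : dual V) : linear phi /\ continuous phi.
Proof. by case: phi => phi /= /[!inE]. Qed.

HB.instance Definition _ V (phi : dual V) :=
  GRing.isLinear.Build R V R^o *:%R phi (dualP phi).1.

(* The operator norm. *)
Definition dual_norm V (phi : dual V) : R :=
  sup [set `|phi v| | v in [set v | `|v| <= 1]].

Let nm_ub V (phi : dual V) : has_sup [set `|phi v| | v in [set v | `|v| <= 1]].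
Proof.
split; first by exists `|phi 0|, 0 => //=; rewrite normr0.
have /linear_bounded_continuous/linear_boundedP/pinfty_ex_gt0[r r0 phir] :=
  (dualP phi).2.
exists r => _ [v/= v1 <-]; rewrite (le_trans (phir v))//.
by rewrite ler_piMr// ltW.
Qed.

Let nm_ge0 V (phi : dual V) : 0 <= dual_norm phi.
Proof.
apply: (le_trans (normr_ge0 (phi 0))); apply: (sup_upper_bound (nm_ub phi)) => /=.
by exists 0 => //=; rewrite normr0.
Qed.

Lemma dual_normP V (phi : dual V) v : `|phi v| <= dual_norm phi * `|v|.
Proof.
have [->|v0] := eqVneq v 0; first by rewrite linear0 !normr0 mulr0.
rewrite -ler_pdivrMr ?normr_gt0//; apply: (sup_upper_bound (nm_ub phi)) => /=.
exists (`|v|^-1 *: v).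
  by rewrite /= normrZ normfV normr_id mulVf// normr_eq0.
by rewrite linearZ/= normrZ normfV normr_id mulrC.
Qed.

Lemma dual_norm_le V (phi : dual V) (K : R) :
  0 <= K -> (forall v, `|phi v| <= K * `|v|) -> dual_norm phi <= K.
Proof.
move=> K0 phiK; apply: ge_sup; first by case: (nm_ub phi).
by move=> _ [v /= v1 <-]; rewrite (le_trans (phiK v))// ler_piMr.
Qed.

Context {V : normedModType R}.
Implicit Types phi psi : dual V.

Let nmD phi psi : dual_norm (phi + psi) <= dual_norm phi + dual_norm psi.
Proof.
apply: dual_norm_le => [|v]; first by rewrite addr_ge0.
by rewrite mulrDl (le_trans (ler_normD _ _))// lerD// dual_normP.
Qed.

Let nmZ_le (a : R) phi : dual_norm (a *: phi) <= `|a| * dual_norm phi.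
Proof.
apply: dual_norm_le => [|v]; first by rewrite mulr_ge0.
by rewrite normrZ -mulrA ler_wpM2l// dual_normP.
Qed.

Let nmZ (a : R) phi : dual_norm (a *: phi) = `|a| * dual_norm phi.
Proof.
apply/eqP; rewrite eq_le nmZ_le/=.
have [->|a0] := eqVneq a 0; first by rewrite normr0 mul0r.
rewrite -ler_pdivlMl ?normr_gt0// -normfV.
by rewrite -{1}[phi](scalerK a0) nmZ_le.
Qed.

Let nm0_eq0 phi : dual_norm phi = 0 -> phi = 0.
Proof.
move=> phi0; apply/val_inj/funext => v /=.
by apply/eqP; rewrite -normr_le0; have := dual_normP phi v; rewrite phi0 mul0r.
Qed.

HB.instance Definition _ := Lmodule_isNormed.Build R (dual V) nmD nmZ nm0_eq0.

Lemma dual_normE phi : `|phi| = dual_norm phi.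
Proof. by []. Qed.

End dual_norm.

Section closed_span.
Context {R : realType} {V : normedModType R}.
Implicit Type A : set V.

Definition lin_span A : set V :=
  [set v | exists n (c : 'I_n -> R) (x : 'I_n -> V),
    (forall i, A (x i)) /\ v = \sum_(i < n) c i *: x i].

Definition closed_span A : {pred V} := mem (closure (lin_span A)).

Lemma lin_span_sub A v : A v -> lin_span A v.
Proof.
move=> Av; exists 1, (fun=> 1), (fun=> v).
by rewrite big_ord1 scale1r.
Qed.

Lemma lin_span_submod A (a : R) u v :
  lin_span A u -> lin_span A v -> lin_span A (a *: u + v).
Proof.
move=> [m [c [x [Ax ->]]]] [n [d [y [Ay ->]]]].
exists (m + n)%N, (fun i => match fintype.split i with
  inl i => a * c i | inr i => d i end), (fun i => match fintype.split i with
  inl i => x i | inr i => y i end); split.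
  by move=> i; case: fintype.split.
rewrite big_split_ord/= scaler_sumr; congr (_ + _); apply: eq_bigr => i _.
  by rewrite (unsplitK (inl i : 'I_m + 'I_n)) scalerA.
by rewrite (unsplitK (inr i : 'I_m + 'I_n)).
Qed.

Lemma closed_spanP A v : v \in closed_span A <->
  forall e : R, 0 < e -> exists2 u, lin_span A u & `|v - u| < e.
Proof.
rewrite inE; split=> [clv e e0|vA B /nbhs_normP[e /= e0 eB]].
  by have [u [Au]] := clv _ (nbhsx_ballx v e e0); rewrite -ball_normE; exists u.
by have [u Au uv] := vA _ e0; exists u; split => //; exact: eB.
Qed.

Lemma closed_span_submod_closed A : submod_closed (closed_span A).
Proof.
split.
  apply/closed_spanP => e e0; exists 0; last by rewrite subrr normr0.
  by exists 0, (fun=> 0), (fun=> 0); split; [case|rewrite big_ord0].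
move=> a u v /closed_spanP uA /closed_spanP vA; apply/closed_spanP => e e0.
have d0 : 0 < e / 2 / (`|a| + 1) by rewrite !divr_gt0// ltr_wpDl.
have [u' Au' uu'] := uA _ d0.
have [v' Av' vv'] := vA (e / 2) (divr_gt0 e0 (ltr0Sn _ _)).
exists (a *: u' + v'); first exact: lin_span_submod.
rewrite opprD addrACA -scalerBr (le_lt_trans (ler_normD _ _))//.
rewrite [ltRHS]splitr ler_ltD// normrZ.
rewrite (le_trans (ler_wpM2l (normr_ge0 a) (ltW uu')))//.
rewrite mulrCA ler_piMr//; first by rewrite divr_ge0// ltW.
by rewrite ler_pdivrMr ?mul1r ?lerDl// ltr_wpDl.
Qed.

HB.instance Definition _ A :=
  GRing.isSubmodClosed.Build R V (closed_span A) (@closed_span_submod_closed A).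

End closed_span.

Section evaluation.
Context {R : realType}.
Implicit Types V W : normedModType R.

Lemma bounded_linear_cts V W (T : {linear V -> W}) (K : R) :
  (forall v, `|T v| <= K * `|v|) -> continuous T.
Proof.
move=> TK; apply/linear_bounded_continuous/linear_boundedP.
exists K; split=> [|r Kr v]; first exact: num_real.
by rewrite (le_trans (TK v))// ler_wpM2r// ltW.
Qed.

Lemma linear_cts_bounded V W (T : {linear V -> W}) :
  continuous T -> exists2 K : R, 0 < K & forall v, `|T v| <= K * `|v|.
Proof. by move=> /linear_bounded_continuous/linear_boundedP/pinfty_ex_gt0. Qed.

Lemma bounded_functional V (phi : V -> R^o) (K : R) : linear phi ->
  (forall v, `|phi v| <= K * `|v|) -> phi \in continuous_functional V.
Proof.
move=> lphi phiK; rewrite inE; split => //.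
pose phil := GRing.isLinear.Build R V R^o *:%R phi lphi.
pose Phi : {linear V -> R^o} := HB.pack phi phil.
exact: (@bounded_linear_cts V R^o Phi K).
Qed.

Context {M : pointedMetricType R}.

Lemma Lip0_le (f : Lip0 M R^o) x : `|f x| <= `|f| * mdist x point.
Proof.
have [f0 fp] := Lip0P f.
have [_ /(_ x point)] := best_lipschitz_constP f0.
by rewrite fp /mdist/= sub0r normrN.
Qed.

Lemma delta_subproof (x : M) :
  (fun f : Lip0 M R^o => f x) \in continuous_functional (Lip0 M R^o).
Proof.
apply: (@bounded_functional _ _ (mdist x point)) => // f.
by rewrite mulrC; exact: Lip0_le.
Qed.

Definition delta (x : M) : dual (Lip0 M R^o) := MkDual (delta_subproof x).

End evaluation.

(* The Lipschitz-free space F(M), with the norm of Lip_0(M)^*. *)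
Record Free (R : realType) (M : pointedMetricType R) := MkFree {
  Free_val :> dual (Lip0 M R^o);
  _ : Free_val \in closed_span (range (@delta R M)) }.

HB.instance Definition _ (R : realType) (M : pointedMetricType R) :=
  [isSub for @Free_val R M].
HB.instance Definition _ (R : realType) (M : pointedMetricType R) :=
  [Choice of Free M by <:].
HB.instance Definition _ (R : realType) (M : pointedMetricType R) :=
  [SubChoice_isSubLmodule of Free M by <:].

Section Free_norm.
Context {R : realType} {M : pointedMetricType R}.
Implicit Types m n : Free M.

Let nm m : R := `|Free_val m|.

Let nmD m n : nm (m + n) <= nm m + nm n.
Proof. exact: ler_normD. Qed.

Let nmZ (a : R) m : nm (a *: m) = `|a| * nm m.
Proof. exact: normrZ. Qed.

Let nm0_eq0 m : nm m = 0 -> m = 0.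
Proof. by move=> /normr0_eq0 m0; exact: val_inj. Qed.

HB.instance Definition _ := Lmodule_isNormed.Build R (Free M) nmD nmZ nm0_eq0.

Lemma Free_normE m : `|m| = `|Free_val m|.
Proof. by []. Qed.

Lemma Free_delta_subproof (x : M) : delta x \in closed_span (range (@delta R M)).
Proof.
apply/closed_spanP => e e0; exists (delta x); last by rewrite subrr normr0.
by apply: lin_span_sub; exists x.
Qed.

Definition Free_delta (x : M) : Free M := MkFree (Free_delta_subproof x).

End Free_norm.

Section linearization.
Context {R : realType} {M N : pointedMetricType R}.

Definition is_linearization (f : Lip0 M N) (T : {linear Free M -> Free N}) :=
  continuous T /\ forall x, T (Free_delta x) = Free_delta (f x).

Lemma linearization_unique (f : Lip0 M N) (T U : {linear Free M -> Free N}) :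
  is_linearization f T -> is_linearization f U -> T =1 U.
Proof.
move=> [/linear_cts_bounded[K K0 TK] Td] [/linear_cts_bounded[L L0 UL] Ud] m.
apply/eqP; rewrite -subr_eq0 -normr_le0; apply/ler_addgt0Pl => e e0.
rewrite addr0.
have KL0 : 0 < e / (K + L) by rewrite divr_gt0// addr_gt0.
have /closed_spanP/(_ _ KL0)[_ [n [c [d [dd ->]]]] mu] := valP m.
have /choice[x xd] : forall i, exists y : M, delta y = d i.
  by move=> i; have [y _ <-] := dd i; exists y.
pose u : Free M := \sum_(i < n) c i *: Free_delta (x i).
have vu : Free_val u = \sum_(i < n) c i *: d i.
  rewrite -[LHS]/(\val u) raddf_sum; apply: eq_bigr => i _.
  by rewrite -xd.
have mue : `|m - u| < e / (K + L) by rewrite -vu in mu.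
have TUu : T u = U u.
  by rewrite !linear_sum; apply: eq_bigr => i _; rewrite !linearZ/= Td Ud.
have -> : T m - U m = T (m - u) - U (m - u).
  by rewrite (raddfB T) (raddfB U)/= TUu opprB addrA subrK.
rewrite (le_trans (ler_normB _ _))// (le_trans (lerD (TK _) (UL _)))//.
by rewrite -mulrDl -ler_pdivlMl ?addr_gt0// mulrC ltW.
Qed.

Section exist.
Variable f : Lip0 M N.

Let C : R := best_lipschitz_const f.

Let fC : lipschitz_consts f C.
Proof. by apply: best_lipschitz_constP; case: (Lip0P f). Qed.

Let C0 : 0 <= C. Proof. by case: fC. Qed.

Let comp_le (g : Lip0 N R^o) : `|Lip0_comp f g| <= C * `|g|.
Proof.
have [_ fL] := fC; apply: best_lipschitz_const_le; split=> [|x y].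
  exact: mulr_ge0.
have [g0 _] := Lip0P g; have [_ gL] := best_lipschitz_constP g0.
rewrite (le_trans (gL _ _))// [C * _]mulrC -mulrA ler_wpM2l//.
by case: (best_lipschitz_constP g0).
Qed.

Lemma dual_push_subproof (phi : dual (Lip0 M R^o)) :
  (fun g : Lip0 N R^o => phi (Lip0_comp f g))
    \in continuous_functional (Lip0 N R^o).
Proof.
apply: (@bounded_functional _ _ _ (dual_norm phi * C)) => [a g h|g].
  by rewrite -linearP; congr (phi _); exact: val_inj.
rewrite (le_trans (dual_normP _ _))// -mulrA ler_wpM2l//.
exact: (normr_ge0 phi).
Qed.

Definition dual_push phi : dual (Lip0 N R^o) := MkDual (dual_push_subproof phi).

Lemma dual_push_linear : linear dual_push.
Proof. by move=> a phi psi; exact: val_inj. Qed.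

HB.instance Definition _ :=
  GRing.isLinear.Build R _ (dual (Lip0 N R^o)) *:%R dual_push dual_push_linear.

Let dual_push_le phi : `|dual_push phi| <= C * `|phi|.
Proof.
apply: dual_norm_le => [|g]; first exact: mulr_ge0.
rewrite (le_trans (dual_normP phi _))//.
by rewrite dual_normE [C * _]mulrC -mulrA ler_wpM2l//; exact: (normr_ge0 phi).
Qed.

Lemma Free_push_subproof (m : Free M) :
  dual_push m \in closed_span (range (@delta R N)).
Proof.
apply/closed_spanP => e e0.
have d0 : 0 < e / (C + 1) by rewrite divr_gt0// ltr_wpDl.
have /closed_spanP/(_ _ d0)[_ [n [c [d [dd ->]]]] mu] := valP m.
exists (\sum_(i < n) c i *: dual_push (d i)).
  exists n, c, (fun i => dual_push (d i)); split => // i.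
  by have [x _ <-] := dd i; exists (f x) => //; exact: val_inj.
rewrite (_ : \sum_(_ < _) _ = dual_push (\sum_(i < n) c i *: d i)).
  rewrite -linearB (le_lt_trans (dual_push_le _))//.
  rewrite (@le_lt_trans _ _ ((C + 1) * `|Free_val m - \sum_(i < n) c i *: d i|))//.
    by rewrite ler_wpM2r// lerDl.
  by rewrite -ltr_pdivlMl ?ltr_wpDl// mulrC.
by rewrite linear_sum; apply: eq_bigr => i _; rewrite linearZ.
Qed.

Definition Free_push (m : Free M) : Free N := MkFree (Free_push_subproof m).

Lemma Free_push_linear : linear Free_push.
Proof. by move=> a m n; apply/val_inj; exact: (linearP dual_push). Qed.

HB.instance Definition _ :=
  GRing.isLinear.Build R (Free M) (Free N) *:%R Free_push Free_push_linear.

Lemma Free_push_linearization : is_linearization f Free_push.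
Proof.
split; last by move=> x; do 2 apply: val_inj.
by apply: (@bounded_linear_cts _ _ _ Free_push C) => m; exact: dual_push_le.
Qed.

Lemma linearization_exists :
  exists T : {linear Free M -> Free N}, is_linearization f T.
Proof. by exists Free_push; exact: Free_push_linearization. Qed.

End exist.

(* The operator usually written \widehat f; it is pinned down by [linearizationP]
   and [linearization_unique]. *)
Definition linearization (f : Lip0 M N) : {linear Free M -> Free N} :=
  sval (cid (linearization_exists f)).

Lemma linearizationP (f : Lip0 M N) : is_linearization f (linearization f).
Proof. by rewrite /linearization; case: cid. Qed.

Lemma linearizationE (f : Lip0 M N) (m : Free M) (g : Lip0 N R^o) :
  linearization f m g = m (Lip0_comp f g).
Proof.
by rewrite (linearization_unique (linearizationP f) (Free_push_linearization f)).
Qed.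

End linearization.

Definition Lip_lin_injective (R : realType) (M : completePointedMetricType R) :=
  forall (N : completePointedMetricType R) (f : Lip0 M N),
    injective f -> injective (linearization f).

(* Lebesgue measurability is Caratheodory measurability, so that [A] need not
   be Borel. *)
Definition positive_lebesgue_measure (R : realType) (A : set R) :=
  ((@wlength R idfun)^*)%mu.-cara.-measurable A /\
  (0 < completed_lebesgue_measure A)%E.

(* A map A -> M is represented by a map R -> M whose values outside [A] are
   irrelevant. *)
Definition bilipschitz_on (R : realType) (M : metricType R) (A : set R)
    (f : R -> M) :=
  exists a b : R, [/\ 0 < a, 0 < b & forall x y, A x -> A y ->
    a * `|x - y| <= mdist (f x) (f y) <= b * `|x - y|].

Definition purely_1_unrectifiable (R : realType) (M : metricType R) :=
  ~ exists (A : set R) (f : R -> M),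
      positive_lebesgue_measure A /\ bilipschitz_on A f.

(* Main.v *)
(* If a subset of positive measure of the line embeds bi-Lipschitzly, so does a
   compact set K of positive measure without rational points. Write p : K -> M
   for the embedding. Integrating the derivative of the curve x |-> delta (p x)
   over K gives an element w of F(M). No differentiability is needed: w is the
   limit of the sums of delta (p d) - delta (p c) over the intervals [c, d] left
   when more and more gaps of K are cut out. A Lipschitz extension of the
   inverse of p takes a positive value at w, as those intervals keep covering K
   up to endpoints. On the other hand, x - |K `&` ]-oo, x]| is strictly
   increasing because K has empty interior, but its increments over those
   intervals add up to a quantity tending to 0. Hence the operator induced by an
   injective Lipschitz map whose distances on p(K) are dominated by this
   function kills w. *)
Require Import Defs.
From HB Require Import structures.
From mathcomp Require Import all_boot all_order all_algebra.
From mathcomp Require Import all_classical all_reals all_analysis.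
From mathcomp Require Import measurable_realfun.
From mathcomp Require Import ring lra.
Import Order.TTheory GRing.Theory Num.Theory.
Import numFieldNormedType.Exports.

Set Implicit Arguments.
Unset Strict Implicit.
Unset Printing Implicit Defensive.

Local Open Scope classical_set_scope.
Local Open Scope ring_scope.

(** * Bounded real functions under the sup distance, a complete pointed metric space *)

Definition bounded_map_pred (R : realType) (T : choiceType) : {pred T -> R^o} :=
  mem [set u : T -> R^o | exists C : R, forall y, `|u y| <= C].

Arguments bounded_map_pred : clear implicits.

Record bounded_map (R : realType) (T : choiceType) := BoundedMap {
  bounded_map_val :> T -> R^o;
  _ : bounded_map_val \in bounded_map_pred R T }.

HB.instance Definition _ (R : realType) (T : choiceType) :=
  [isSub for @bounded_map_val R T].
HB.instance Definition _ (R : realType) (T : choiceType) :=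
  [Choice of bounded_map R T by <:].

Section bounded_map_metric.
Context {R : realType} {T : choiceType}.
Implicit Types u v w : bounded_map R T.

Definition sup_dist u v : R := sup [set `|u y - v y| | y in [set: T]].

Lemma sup_dist_ge u v y : `|u y - v y| <= sup_dist u v.
Proof.
apply: ub_le_sup; last by exists y.
have := valP u; rewrite inE => -[C uC]; have := valP v; rewrite inE => -[D vD].
exists (C + D) => _ [z _ <-].
by rewrite (le_trans (ler_normB _ _))// lerD//; [exact: uC|exact: vD].
Qed.

Lemma sup_dist_le u v (C : R) : 0 <= C -> (forall y, `|u y - v y| <= C) ->
  sup_dist u v <= C.
Proof.
move=> C0 uvC.
(* [T] may be empty; the sup then has its default value 0, whence the assumption [0 <= C]. *)
have [S0|/set0P S0] := eqVneq [set `|u y - v y| | y in setT] set0.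
  by rewrite /sup_dist S0 sup0.
by apply: ge_sup => // _ [y _ <-].
Qed.

Lemma sup_dist_ge0 u v : 0 <= sup_dist u v.
Proof.
have [S0|/set0P[_ [y _ _]]] := eqVneq [set `|u y - v y| | y in setT] set0.
  by rewrite /sup_dist S0 sup0.
exact: le_trans (sup_dist_ge u v y).
Qed.

Let sup_distxx u : sup_dist u u = 0.
Proof.
apply/eqP; rewrite eq_le sup_dist_ge0 andbT.
by apply: sup_dist_le => // y; rewrite subrr normr0.
Qed.

Let sup_dist_pos u v : sup_dist u v = 0 -> u = v.
Proof.
move=> uv0; apply/val_inj/funext => y /=; apply/eqP.
by rewrite -subr_eq0 -normr_le0 -uv0 sup_dist_ge.
Qed.

Let sup_dist_sym u v : sup_dist u v = sup_dist v u.
Proof.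
by congr sup; apply/seteqP; split => _ [y _ <-]; exists y; rewrite // distrC.
Qed.

Let sup_dist_triangle v u w : sup_dist u w <= sup_dist u v + sup_dist v w.
Proof.
apply: sup_dist_le => [|y]; first by rewrite addr_ge0// sup_dist_ge0.
by rewrite (le_trans (ler_distD (v y) _ _))// lerD// sup_dist_ge.
Qed.

HB.instance Definition _ := isMetric.Build R (bounded_map R T)
  sup_distxx sup_dist_pos sup_dist_sym sup_dist_triangle.

Lemma bounded_map0_subproof : (fun=> 0) \in bounded_map_pred R T.
Proof. by rewrite inE; exists 0 => y; rewrite normr0. Qed.

HB.instance Definition _ := isPointed.Build (bounded_map R T)
  (BoundedMap bounded_map0_subproof).

(** A Cauchy filter converges pointwise since the line is complete. If a ball of radius [e] around
    [u] belongs to [F], the bound [e] passes to the pointwise limit uniformly in [y], so this limit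
    is bounded and is also the limit in sup distance. *)
Let bounded_map_complete (F : set_system (bounded_map R T)) :
  ProperFilter F -> cauchy F -> cvg F.
Proof.
move=> FF /cauchyP cF.
have cvF y : cvg ((fun u : bounded_map R T => u y) @ F).
  apply: cauchy_cvg; apply: cauchy_exP => e e0; have [u Fu] := cF e e0.
  exists (u y).
  suff : F ((fun w : bounded_map R T => w y) @^-1` ball (u y : R^o) e) by [].
  apply: filterS Fu => v; rewrite /preimage /= !ballEmdist /=.
  apply: le_lt_trans; rewrite /mdist/= distrC.
  exact: sup_dist_ge.
pose L y : R^o := lim ((fun u : bounded_map R T => u y) @ F).
have LE (u : bounded_map R T) e : F (ball u e) -> forall y, `|u y - L y| <= e.
  move=> Fu y; apply/ler_addgt0Pr => d d0.
  have /cvgr_dist_lt/(_ _ d0) Fy := cvF y.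
  have [v [/=]] := filter_ex (filterI Fu Fy).
  rewrite ballEmdist/= => uv vL.
  rewrite (le_trans (ler_distD (v y) _ _))// lerD//.
    by rewrite ltW// (le_lt_trans (sup_dist_ge _ _ _)).
  by rewrite distrC ltW.
have Lb : L \in bounded_map_pred R T.
  rewrite inE; have [u /LE uL] := cF 1 ltr01.
  have := valP u; rewrite inE => -[C uC]; exists (1 + C) => y.
  rewrite -(subrK (u y) (L y)) (le_trans (ler_normD _ _))// distrC.
  by rewrite lerD//; exact: uC.
suff FL : F --> (BoundedMap Lb : bounded_map R T).
  by apply/cvg_ex; exists (BoundedMap Lb).
apply/metricType_numDomainType.fcvgrPdist_lt => e e0.
(* A sup inherits only non-strict bounds, so two quarters of [e] leave room for a strict one. *)
have e20 : 0 < e / 2 / 2 by rewrite !divr_gt0.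
have [u Fu] := cF _ e20; apply: filterS (Fu) => v.
rewrite ballEmdist/= => uv.
have /le_lt_trans-> // : sup_dist (BoundedMap Lb) v <= e / 2 / 2 + e / 2 / 2.
  apply: sup_dist_le => [|y]; first by rewrite addr_ge0// ltW.
  rewrite (le_trans (ler_distD (u y) _ _))// lerD//; first by rewrite distrC LE.
  by rewrite (le_trans (sup_dist_ge _ _ _))// ltW.
by lra.
Qed.

HB.instance Definition _ := Uniform_isComplete.Build (bounded_map R T)
  bounded_map_complete.

End bounded_map_metric.

(** * Increments over what bisection leaves of an interval once gaps of a closed set are cut out *)

Section gap_sum.
Context {R : realType}.
Variable K : set R.

(** For closed [K] with points on both sides of [t], these are the ends of the gap of [K] around
    [t], or [t] itself when [t] is in [K]. *)
Definition lpoint (t : R) : R := sup (K `&` `]-oo, t]).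
Definition rpoint (t : R) : R := inf (K `&` `[t, +oo[).

(* Each bisection step trades [c, d] for the two pieces left once the gap of K
   around the midpoint, if there is one, is removed. *)
Fixpoint gap_sum (V : zmodType) (G : R -> V) (n : nat) (c d : R) : V :=
  if n is n'.+1 then
    gap_sum G n' c (lpoint ((c + d) / 2)) +
    gap_sum G n' (rpoint ((c + d) / 2)) d
  else G d - G c.

Hypothesis Kclosed : closed K.

Lemma lpointP (c t : R) : K c -> c <= t ->
  [/\ K (lpoint t), c <= lpoint t, lpoint t <= t &
      forall x, K x -> x <= t -> x <= lpoint t].
Proof.
move=> Kc ct.
have KS : has_sup (K `&` `]-oo, t]).
  split; first by exists c; split => //=; rewrite in_itv.
  by exists t => x [_]/=; rewrite in_itv.
have ub x : K x -> x <= t -> x <= lpoint t.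
  by move=> Kx xt; apply: sup_upper_bound => //; split => //=; rewrite in_itv.
have cl : closed (K `&` `]-oo, t]).
  by apply: closedI => //; exact: interval_closed.
have [] : (K `&` `]-oo, t]) (lpoint t).
  by apply: cl; apply: closure_sup => //; case: KS.
by move=> Kl /=; rewrite in_itv/= => lt; split => //; exact: ub.
Qed.

Lemma rpointP (d t : R) : K d -> t <= d ->
  [/\ K (rpoint t), rpoint t <= d, t <= rpoint t &
      forall x, K x -> t <= x -> rpoint t <= x].
Proof.
move=> Kd td.
have KS : has_inf (K `&` `[t, +oo[).
  split; first by exists d; split => //=; rewrite in_itv/= td.
  by exists t => x [_]/=; rewrite in_itv/= andbT.
have lb x : K x -> t <= x -> rpoint t <= x.
  move=> Kx xt; apply: ge_inf; first by case: KS.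
  by split => //=; rewrite in_itv/= xt.
have cl : closed (K `&` `[t, +oo[).
  by apply: closedI => //; exact: interval_closed.
have [] : (K `&` `[t, +oo[) (rpoint t).
  apply: cl => B /nbhs_ballP[e /= e0 eB].
  have [x Sx xe] := inf_adherent e0 KS; exists x; split => //; apply: eB.
  rewrite /ball/= distrC ger0_norm ?subr_ge0 ?ltrBlDl//.
  by case: Sx => Kx /=; rewrite in_itv/= andbT => /(lb _ Kx).
by move=> Kl /=; rewrite in_itv/= andbT => lt; split => //; exact: lb.
Qed.

Lemma gap_split (c d : R) : K c -> K d -> c <= d ->
  let l := lpoint ((c + d) / 2) in let r := rpoint ((c + d) / 2) in
  [/\ K l, K r, c <= l, r <= d &
      [/\ l <= (c + d) / 2, (c + d) / 2 <= r &
          forall x, K x -> x <= l \/ r <= x]].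
Proof.
move=> Kc Kd cd l r.
have cm : c <= (c + d) / 2 by lra.
have md : (c + d) / 2 <= d by lra.
have [Kl cl lm lP] := lpointP Kc cm; have [Kr rd mr rP] := rpointP Kd md.
split => //; split => // x Kx.
by have [xm|/ltW mx] := leP x ((c + d) / 2); [left; exact: lP|right; exact: rP].
Qed.

Lemma eq_gap_sum (V : zmodType) (G H : R -> V) n c d :
  (forall x y, K x -> K y -> x <= y -> G y - G x = H y - H x) ->
  K c -> K d -> c <= d -> gap_sum G n c d = gap_sum H n c d.
Proof.
move=> GH; elim: n c d => [|n IH] c d Kc Kd cd /=; first exact: GH.
have [Kl Kr cl rd [lm mr _]] := gap_split Kc Kd cd.
by rewrite !IH.
Qed.

Section lipschitz.
Context {V : normedModType R}.
Variables (G : R -> V) (h : R -> R) (C : R).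
Hypothesis Gh : forall x y, K x -> K y -> x <= y ->
  `|G y - G x| <= C * (h y - h x).

Lemma gap_sum_norm n c d : K c -> K d -> c <= d ->
  `|gap_sum G n c d| <= C * gap_sum h n c d.
Proof.
elim: n c d => [|n IH] c d Kc Kd cd /=; first exact: Gh.
have [Kl Kr cl rd [lm mr _]] := gap_split Kc Kd cd.
by rewrite (le_trans (ler_normD _ _))// mulrDr lerD// IH.
Qed.

(** The difference is the total increment of [G] across the removed gaps, and across each gap [h]
    dominates [G]. *)
Lemma gap_sum_dist0 n c d : K c -> K d -> c <= d ->
  `|gap_sum G 0 c d - gap_sum G n c d| <=
    C * (gap_sum h 0 c d - gap_sum h n c d).
Proof.
elim: n c d => [|n IH] c d Kc Kd cd; first by rewrite !subrr normr0 mulr0.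
have [Kl Kr cl rd [lm mr _]] := gap_split Kc Kd cd => /=.
set l := lpoint _ in Kl cl lm *; set r := rpoint _ in Kr rd mr *.
(* The increment over [[c, d]] splits into that of the gap [[l, r]] and those of the two outer
   pieces, where induction applies. *)
have -> : G d - G c - (gap_sum G n c l + gap_sum G n r d) =
    (G r - G l) + (gap_sum G 0 c l - gap_sum G n c l) +
    (gap_sum G 0 r d - gap_sum G n r d).
  have -> : G d - G c = (G r - G l) + (G l - G c) + (G d - G r).
    by rewrite [RHS]addrC !addrA !subrK.
  by rewrite opprD addrACA; congr (_ + _); rewrite -addrA.
rewrite (le_trans (ler_normD _ _))//.
rewrite (le_trans (lerD (ler_normD _ _) (lexx _)))//.
have := IH _ _ Kc Kl cl; have := IH _ _ Kr Kd rd => /=.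
have := Gh Kl Kr (le_trans lm mr).
lra.
Qed.

Lemma gap_sum_dist m n c d : K c -> K d -> c <= d -> (m <= n)%N ->
  `|gap_sum G m c d - gap_sum G n c d| <=
    C * (gap_sum h m c d - gap_sum h n c d).
Proof.
elim: m n c d => [|m IH] [//|n] c d Kc Kd cd mn; try exact: gap_sum_dist0.
have [Kl Kr cl rd [lm mr _]] := gap_split Kc Kd cd => /=.
rewrite opprD [X in `|X|]addrACA (le_trans (ler_normD _ _))//.
by have := IH _ _ _ Kc Kl cl mn; have := IH _ _ _ Kr Kd rd mn; lra.
Qed.

End lipschitz.

(** The removed gaps carry nonnegative increments of [G]. *)
Lemma gap_sum_mono (G : R -> R) n c d :
  (forall x y, K x -> K y -> x <= y -> G x <= G y) ->
  K c -> K d -> c <= d -> gap_sum G n c d <= G d - G c.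
Proof.
move=> Gh; elim: n c d => [//|n IH] c d Kc Kd cd /=.
have [Kl Kr cl rd [lm mr _]] := gap_split Kc Kd cd.
have := IH _ _ Kc Kl cl; have := IH _ _ Kr Kd rd.
have := Gh _ _ Kl Kr (le_trans lm mr); lra.
Qed.

(** The pieces removed have no point of [K] inside, so they carry no increment and the sum
    telescopes. *)
Lemma gap_sum_cst_gap (G : R -> R) n c d :
  (forall x y, K x -> K y -> x <= y -> K `&` `]x, y[ = set0 -> G x = G y) ->
  K c -> K d -> c <= d -> gap_sum G n c d = G d - G c.
Proof.
move=> GE; elim: n c d => [//|n IH] c d Kc Kd cd /=.
have [Kl Kr cl rd [lm mr lr]] := gap_split Kc Kd cd.
rewrite !IH// (GE _ _ Kl Kr (le_trans lm mr)); first by rewrite addrC subrKA.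
apply/seteqP; split => // x [Kx] /=; rewrite in_itv/= => /andP[lx xr].
by have [] := lr x Kx; lra.
Qed.

(** Each bisection at least halves the lengths, so after [n] steps every remaining interval has
    length at most [e]. *)
Lemma eq_gap_sum_small (G H : R -> R) (e : R) n c d :
  (forall x y, K x -> K y -> x <= y -> y - x <= e -> G y - G x = H y - H x) ->
  K c -> K d -> c <= d -> d - c <= 2 ^+ n * e ->
  gap_sum G n c d = gap_sum H n c d.
Proof.
move=> GH; elim: n c d => [|n IH] c d Kc Kd cd /=.
  by rewrite expr0 mul1r; exact: GH.
rewrite exprS -mulrA => cde.
have [Kl Kr cl rd [lm mr lr]] := gap_split Kc Kd cd.
by rewrite !IH//; lra.
Qed.

Lemma gap_sumB (V : zmodType) (G H : R -> V) n c d :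
  gap_sum (G \- H) n c d = gap_sum G n c d - gap_sum H n c d.
Proof.
elim: n c d => [|n IH] c d /=; last by rewrite !IH opprD addrACA.
by rewrite !opprB [H c - G c]addrC addrACA [- H d + _]addrC.
Qed.

End gap_sum.

(** * Lebesgue measure: compact subsets, distribution functions and thickenings *)

Section measure.
Context {R : realType}.
Notation leb := (@lebesgue_measure R).

(** The closure of [A] is Borel and has at least the measure of [A]; deleting the rationals, a null
    set, and applying inner regularity gives [K]. Since [K] may leave [A], the embedding must be
    extended to the closure. *)
Lemma positive_measure_compact (A : set R) : positive_lebesgue_measure A ->
  exists K : set R, [/\ compact K, K `<=` closure A,
    (forall q : rat, ~ K (ratr q)) & (0 < leb K)%E].
Proof.
move=> [_ A0].
have cA0 : (0 < leb (closure A))%E.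
  apply: lt_le_trans A0 _.
  exact: (@le_outer_measure _ _ (wlength idfun)^*%mu _ _ (@subset_closure _ A)).
have mQ : measurable (range ratr : set R).
  apply: countable_measurable; first by move=> x; exact: measurable_set1.
  exact: (sub_countable (card_image_le _ _) (countableP [set: rat])).
have mcA : measurable (closure A).
  by apply: closed_measurable; exact: closed_closure.
have mD : measurable (closure A `\` range ratr) by exact: measurableD.
have D0 : (0 < leb (closure A `\` range ratr))%E.
  rewrite (lt_le_trans cA0)//.
  have := measureU2 leb mD mQ.
  rewrite [X in (_ + X)%E]lebesgue_measure_rat adde0; apply: le_trans.
  apply: le_measure; rewrite ?inE//; first exact: measurableU.
  by move=> x cx; have [Qx|Qx] := pselect (range ratr x); [right|left].
rewrite lebesgue_regularity_inner_sup// in D0.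
have [_ [K [cK KD] <-] K0] := ereal_sup_gt D0.
exists K; split => // [x /KD[]//|q /KD[_]]; apply.
by exists q.
Qed.

Section cdf.
Variable E : set R.
Hypothesis mE : measurable E.
Hypothesis E_fin : (leb E < +oo)%E.

Definition cdf (x : R) : R := fine (leb (E `&` `]-oo, x])).

Lemma cdfB x y : x <= y ->
  leb (E `&` `]x, y]) = (cdf y - cdf x)%:E.
Proof.
move=> xy.
have fin B : measurable B -> leb (E `&` B) \is a fin_num.
  move=> mB; rewrite ge0_fin_numE// (le_lt_trans _ E_fin)//.
  by rewrite le_measure ?inE//; exact: measurableI.
have UE : E `&` `]-oo, y] = (E `&` `]-oo, x]) `|` (E `&` `]x, y]).
  rewrite -setIUr; congr (_ `&` _).
  apply/seteqP; split => z /=; rewrite !in_itv/=.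
    by move=> zy; have [zx|xz] := leP z x; [left|right; rewrite zy].
  by move=> [zx|/andP[]//]; exact: le_trans xy.
rewrite /cdf EFinB !fineK; try exact: fin.
rewrite UE measureU//; try exact: measurableI.
  by rewrite addeAC subee ?add0e//; exact: fin.
apply/seteqP; split => // z [[_ /=]] + [_]; rewrite !in_itv/= => zx /andP[].
by rewrite ltNge zx.
Qed.

Lemma cdf_mono x y : x <= y -> cdf x <= cdf y.
Proof. by move=> xy; rewrite -subr_ge0 -lee_fin -cdfB// measure_ge0. Qed.

Lemma cdf_lip x y : x <= y -> cdf y - cdf x <= y - x.
Proof.
move=> xy; rewrite -lee_fin -cdfB//.
have EI : (leb (E `&` `]x, y]) <= leb `]x, y])%E.
  by apply: le_measure; rewrite ?inE//; exact: measurableI.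
rewrite (le_trans EI)// lebesgue_measure_itv/= lte_fin.
by case: ifP => // _; rewrite lee_fin subr_ge0.
Qed.

(** Within []x, y]], only the endpoint [y] can belong to [E], and a point is null. *)
Lemma cdf_gap x y : x <= y -> E `&` `]x, y[ = set0 -> cdf x = cdf y.
Proof.
move=> xy E0; apply/eqP; rewrite eq_sym -subr_eq0 -eqe -cdfB//.
rewrite -measure_le0 (@le_trans _ _ (leb [set y]))//; last first.
  by rewrite lebesgue_measure_set1.
apply: le_measure; rewrite ?inE//; first exact: measurableI.
move=> z [Ez /=]; rewrite in_itv/= => /andP[xz zy].
apply: contrapT => /eqP zny.
have : (E `&` `]x, y[) z by split => //=; rewrite in_itv/= xz lt_neqAle zny.
by rewrite E0.
Qed.

Lemma cdf_full x y : x <= y -> `]x, y] `<=` E -> cdf y - cdf x = y - x.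
Proof.
move=> xy xyE; apply: EFin_inj; rewrite -cdfB// setIidr//.
rewrite lebesgue_measure_itv/= lte_fin; case: ltgtP xy => // -> _.
by rewrite subrr.
Qed.

(** A rational between [x] and [y] has a neighbourhood that misses [E], on which [cdf] is constant;
    elsewhere [cdf] grows no faster than length. *)
Lemma cdf_ltB x y : x < y -> closed E -> (forall q : rat, ~ E (ratr q)) ->
  cdf y - cdf x < y - x.
Proof.
move=> xy cE Eq; have [q] := rat_in_itvoo xy; rewrite in_itv/= => /andP[xq qy].
have /nbhs_ballP[e /= e0 eE] : nbhs (ratr q : R) (~` E).
  by apply: open_nbhs_nbhs; split; [exact: closed_openC|exact: Eq].
pose d : R := Num.min (e / 2) (y - ratr q).
have d0 : 0 < d by rewrite lt_min divr_gt0//= subr_gt0.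
have [de dy] : d <= e / 2 /\ d <= y - ratr q.
  by rewrite !ge_min !lexx orbT.
have : cdf (ratr q) = cdf (ratr q + d).
  apply: cdf_gap; first by lra.
  apply/seteqP; split => // z [Ez /=]; rewrite in_itv/= => /andP[qz zq].
  apply: (eE z) => //; rewrite /ball/= ltr_norml; apply/andP; split; lra.
have qdy : ratr q + d <= y by lra.
have := cdf_lip qdy; have := cdf_lip (ltW xq); lra.
Qed.

End cdf.


Definition thickening (E : set R) (n : nat) : set R :=
  \bigcup_(x in E) ball x n.+1%:R^-1.

Lemma thickening_measurable E n : measurable (thickening E n).
Proof.
apply: open_measurable; apply: bigcup_open => x _; exact: ball_open.
Qed.

(** Continuity of measure from above requires a first set of finite measure. *)
Lemma thickening0_fin E : compact E -> (leb (thickening E 0) < +oo)%E.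
Proof.
move=> /compact_bounded[B [_ /(_ (B + 1))]]; rewrite ltrDl => /(_ ltr01) EB.
rewrite (@le_lt_trans _ _ (leb `[- (B + 2), B + 2]))//.
  apply: le_measure; rewrite ?inE//; first exact: thickening_measurable.
  move=> y [x /EB /=]; rewrite invr1 /ball/= in_itv/= !ler_norml ltr_norml.
  by move=> /andP[? ?] /andP[? ?]; apply/andP; split; lra.
rewrite lebesgue_measure_itv/= lte_fin.
by case: ifP => // _; rewrite -EFinB ltry.
Qed.

(** A closed set is the intersection of its thickenings, so continuity from above applies. *)
Lemma thickening_cvg E : compact E -> leb \o thickening E @ \oo --> leb E.
Proof.
move=> cE.
have clE : closed E by apply: compact_closed => //; exact: Rhausdorff.
have bE : \bigcap_n thickening E n = E.
  apply/seteqP; split => [x Ex|x Ex n _]; last first.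
    by exists x => //; exact: ballxx.
  apply: clE => B /nbhs_ballP[e /= e0 eB].
  have [n ne] : exists n, n.+1%:R^-1 < e.
    have [n _ /(_ n (leqnn n))] := near_infty_natSinv_lt (PosNum e0).
    by exists n.
  have [y Ey yx] := Ex n I; exists y; split => //; apply: eB.
  by apply: ball_sym; apply: le_ball yx; exact: ltW.
rewrite -[X in _ --> leb X]bE; apply: nonincreasing_cvg_mu.
- exact: thickening0_fin.
- by move=> n; exact: thickening_measurable.
- by apply: bigcapT_measurable => n; exact: thickening_measurable.
- move=> m n mn; apply/subsetPset => x [y Ey yx]; exists y => //.
  by apply: le_ball yx; rewrite lef_pV2 ?posrE// ler_nat ltnS.
Qed.

(** Choose a thickening [T] of [K] with excess measure below [e]. Once the remaining intervals are
    shorter than its radius they lie in [T] up to left ends, so their total length is at most the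
    measure of [T] in []c, d]]. The gap sum of [cdf K] is exactly the measure of [K] there, and the
    difference is at most the measure of [T] minus [K]. *)
Lemma gap_sum_cdf_cvg0 (K : set R) (c d : R) : compact K ->
  K c -> K d -> c <= d ->
  forall e : R, 0 < e -> exists N, forall n, (N <= n)%N ->
  gap_sum K (fun x => x - cdf K x) n c d < e.
Proof.
move=> cK Kc Kd cd e e0.
have clK : closed K by apply: compact_closed => //; exact: Rhausdorff.
have mK := compact_measurable cK.
have fK := compact_finite_measure cK.
have [j Tj] : exists j, (leb (thickening K j) < leb K + e%:E)%E.
  have fT := thickening0_fin cK.
  have /fine_cvgP[_ /cvgrPdist_lt/(_ _ e0)[j _ /(_ j (leqnn j))/=]] :
      leb \o thickening K @ \oo --> (fine (leb K))%:E.
    by rewrite fineK ?ge0_fin_numE//; exact: thickening_cvg.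
  rewrite ltr_norml => /andP[ej _]; exists j.
  rewrite -[leb K]fineK ?ge0_fin_numE// -[leb (thickening _ _)]fineK.
    by rewrite -EFinD lte_fin; lra.
  rewrite ge0_fin_numE// (le_lt_trans _ fT)//.
  apply: le_measure; rewrite ?inE; try exact: thickening_measurable.
  move=> x [y Ey yx]; exists y => //.
  by apply: le_ball yx; rewrite lef_pV2 ?posrE// ler_nat.
set T := thickening K j in Tj.
have mT : measurable T by exact: thickening_measurable.
have fT : (leb T < +oo)%E.
  by rewrite (lt_le_trans Tj)// leey.
have KT : K `<=` T by move=> x Kx; exists x => //; exact: ballxx.
have [N dN] : exists N, d - c <= 2 ^+ N * j.+1%:R^-1.
  exists (Num.bound ((d - c) * j.+1%:R)); rewrite ler_pdivlMr//.
  rewrite (le_trans (ltW (archi_boundP _)))//.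
    by rewrite mulr_ge0// subr_ge0.
  by rewrite -natrX ler_nat ltnW// ltn_expl.
exists N => n Nn.
have -> : gap_sum K (fun x => x - cdf K x) n c d =
    gap_sum K id n c d - gap_sum K (cdf K) n c d.
  exact: (gap_sumB K id (cdf K)).
rewrite (gap_sum_cst_gap (G := cdf K) clK _ _ Kc Kd cd); last first.
  by move=> x y _ _ xy; exact: cdf_gap.
have -> : gap_sum K id n c d = gap_sum K (cdf T) n c d.
  apply: (eq_gap_sum_small clK (e := j.+1%:R^-1)) => //; last first.
    by rewrite (le_trans dN)// ler_wpM2r// ler_weXn2l// ler1n.
  (* Excluding the left end [x] gives the strict inequality for the open ball around [y]. *)
  move=> x y Kx Ky xy yxe; apply/esym/cdf_full => // z/=.
  rewrite in_itv/= => /andP[xz zy]; exists y => //.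
  have j0 : 0 < j.+1%:R^-1 :> R by rewrite invr_gt0.
  rewrite /ball/=; move: (j.+1%:R^-1) j0 yxe => i i0 yxi.
  rewrite ltr_norml; apply/andP; split; lra.
apply: (@le_lt_trans _ _ ((cdf T d - cdf T c) - (cdf K d - cdf K c))).
  rewrite lerB//; apply: gap_sum_mono => // x y _ _; exact: cdf_mono.
rewrite -lte_fin EFinB -!cdfB//.
have TD : leb T = (leb (T `\` K) + leb K)%E.
  by rewrite (measureDI leb mT mK) (setIidr KT).
have finK : leb K \is a fin_num by rewrite ge0_fin_numE.
have finKI : leb (K `&` `]c, d]) \is a fin_num.
  rewrite ge0_fin_numE// (le_lt_trans _ fK)//.
  by rewrite le_measure ?inE//; exact: measurableI.
rewrite lteBlDl//.
apply: (@le_lt_trans _ _ (leb (K `&` `]c, d]) + leb (T `\` K))%E).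
  have mKI : measurable (K `&` `]c, d]) by exact: measurableI.
  have mTK : measurable (T `\` K) by exact: measurableD.
  apply: le_trans (measureU2 leb mKI mTK).
  apply: le_measure; rewrite ?inE//; [exact: measurableI|exact: measurableU|].
  by move=> x [Tx xI]; have [Kx|Kx] := pselect (K x); [left|right].
rewrite lteD2lE//.
by move: Tj; rewrite TD addeC lteD2lE.
Qed.

End measure.

(** * Limits of functionals and of embeddings *)

(** The limit is pointwise. The rate [e] is kept in the conclusion because later estimates need it,
    beyond mere convergence. *)
Lemma dual_cauchy_cvg (R : realType) (V : normedModType R)
    (u : nat -> dual V) (e : nat -> R) :
  (forall m n, (m <= n)%N -> `|u m - u n| <= e m) ->
  (forall d, 0 < d -> exists n, e n < d) ->
  exists phi : dual V, forall n, `|u n - phi| <= e n.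
Proof.
move=> ue e0.
have uev m n v : (m <= n)%N -> `|u m v - u n v| <= e m * `|v|.
  move=> mn; have := dual_normP (u m - u n) v.
  by move=> /le_trans; apply; rewrite ler_wpM2r//; exact: ue.
have cu v : cvgn (fun n => u n v).
  apply: cauchy_cvg; apply: cauchy_exP => d d0.
  have v1 : 0 < `|v| + 1 by rewrite ltr_wpDl.
  have [N eN] := e0 _ (divr_gt0 d0 v1).
  exists (u N v); exists N => // n /= Nn; rewrite /ball/=.
  rewrite (le_lt_trans (uev _ _ _ Nn))//.
  move: eN; rewrite ltr_pdivlMr// => /(le_lt_trans _); apply.
  by rewrite ler_wpM2l ?lerDl// (le_trans (normr_ge0 _) (ue _ _ (leqnn N))).
pose L v : R^o := limn (fun n => u n v).
have uL n v : `|u n v - L v| <= e n * `|v|.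
  apply/ler_addgt0Pr => d d0.
  have /cvgrPdist_lt/(_ _ d0)[N _ NL] := cu v.
  have := NL (maxn n N) (leq_maxr _ _).
  have := uev n (maxn n N) v (leq_maxl _ _).
  rewrite -/(L v) => un Lu.
  by rewrite (le_trans (ler_distD (u (maxn n N) v) _ _))// lerD// distrC ltW.
have Ll : linear L.
  move=> a v w; rewrite /L.
  have -> : (fun n => u n (a *: v + w)) = (fun n => a *: u n v + u n w).
    by apply/funext => n; rewrite linearP.
  apply/cvg_lim => //; apply: cvgD; last exact: cu.
  by apply: cvgZr; exact: cu.
have Lb : L \in continuous_functional V.
  apply: (@bounded_functional _ _ _ (`|u 0| + e 0)) => // v.
  rewrite mulrDl -(subKr (u 0%N v) (L v)) (le_trans (ler_normB _ _))//.
  by rewrite lerD//; exact: dual_normP.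
exists (MkDual Lb) => n; apply: dual_norm_le => [|v]; last exact: uL.
exact: le_trans (normr_ge0 _) (ue _ _ (leqnn n)).
Qed.

(** [f] maps the trace on [A] of the neighbourhoods of a point to a Cauchy filter, which converges
    as [M] is complete. The two-sided bounds pass to the limit with the same constants. *)
Lemma bilipschitz_closure (R : realType) (M : completePointedMetricType R)
    (A : set R) (f : R -> M) :
  bilipschitz_on A f -> exists g : R -> M, bilipschitz_on (closure A) g.
Proof.
move=> [a [b [a0 b0 fab]]].
pose P t p := forall e : R, 0 < e ->
  exists s, [/\ A s, `|s - t| < e & mdist (f s) p < e].
have /choice[g gP] : forall t, exists p : M, closure A t -> P t p.
  move=> t; have [clt|] := pselect (closure A t); last by exists point.
  have FF : ProperFilter (within A (nbhs t)).
    exact: within_nbhs_proper.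
  have : cauchy (f @ within A (nbhs t)).
    apply: cauchy_exP => e e0.
    have d0 : 0 < e / b / 2 by rewrite !divr_gt0.
    have [x [Ax tx]] := clt _ (nbhsx_ballx t _ d0).
    exists (f x). rewrite ballEmdist.
    have : \forall y \near within A (nbhs t), mdist (f x) (f y) < e; last by [].
    rewrite near_withinE; near=> y => Ay.
    have /andP[_ /le_lt_trans] := fab _ _ Ax Ay; apply.
    rewrite mulrC -ltr_pdivlMr//.
    have ty : ball t (e / b / 2) y by near: y; exact: nbhsx_ballx.
    rewrite (le_lt_trans (ler_distD t _ _))// (splitr (e / b)) ltrD//.
    by rewrite distrC.
  move=> /cauchy_cvg/cvg_ex[p fp]; exists p => _ e e0.
  have /metricType_numDomainType.cvgrPdist_lt/(_ _ e0) H := fp.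
  have H2 : \forall s \near within A (nbhs t), A s by exact: withinT.
  have H3 : \forall s \near within A (nbhs t), ball t e s.
    by apply: cvg_within; exact: nbhsx_ballx.
  have [s [[/= ps As] ts]] := filter_ex (filterI (filterI H H2) H3).
  exists s; split => //; first by rewrite distrC.
  by rewrite metric_sym.
have approx x y d : closure A x -> closure A y -> 0 < d -> exists s s',
    [/\ a * `|s - s'| <= mdist (f s) (f s') <= b * `|s - s'|,
        `|x - y| <= `|s - s'| + 2 * d, `|s - s'| <= `|x - y| + 2 * d,
        mdist (g x) (g y) <= mdist (f s) (f s') + 2 * d &
        mdist (f s) (f s') <= mdist (g x) (g y) + 2 * d].
  move=> cx cy d0; have [s [As sx sp]] := gP _ cx _ d0.
  have [s' [As' sy sp']] := gP _ cy _ d0.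
  exists s, s'; split; first exact: fab.
  - have := ler_distD s x y; have := ler_distD s' s y; rewrite (distrC x s).
    lra.
  - have := ler_distD x s s'; have := ler_distD y x s'; rewrite (distrC y s').
    lra.
  - have := metric_triangle (g x) (f s) (g y).
    have := metric_triangle (f s) (f s') (g y).
    rewrite (metric_sym (g x) (f s)).
    lra.
  - have := metric_triangle (f s) (g x) (f s').
    have := metric_triangle (g x) (g y) (f s').
    rewrite (metric_sym (g y) (f s')).
    lra.
exists g, a, b; split => // x y cx cy.
apply/andP; split; apply/ler_addgt0Pr => e e0.
  (* Replacing both points costs [2 * d] in [M] and [a * (2 * d)] on the line, together [e]. *)
  have d0 : 0 < e / (2 * (a + 1)) by rewrite divr_gt0// mulr_gt0// addr_gt0.
  have [s [s' [/andP[+ _] xs _ _ sg]]] := approx _ _ _ cx cy d0.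
  have de : e = 2 * (a + 1) * (e / (2 * (a + 1))) by field; lra.
  have := ler_wpM2l (ltW a0) xs; move: (e / _) sg de => d; lra.
have d0 : 0 < e / (2 * (b + 1)) by rewrite divr_gt0// mulr_gt0// addr_gt0.
have [s [s' [/andP[_ +] _ sx gs _]]] := approx _ _ _ cx cy d0.
have de : e = 2 * (b + 1) * (e / (2 * (b + 1))) by field; lra.
have := ler_wpM2l (ltW b0) sx; move: (e / _) gs de => d; lra.
Unshelve. all: by end_near. Qed.

(** * Lipschitz extension, and injective maps controlled on a given set *)

(** This is the McShane formula, the infimum of [h x + L * mdist z (p x)]. Indexing by [p] avoids
    naming its inverse. *)
Lemma mcshane_extension (R : realType) (M : metricType R) (T : Type) (X : set T)
    (p : T -> M) (h : T -> R) (L : R) : 0 <= L -> X !=set0 ->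
  (forall x y, X x -> X y -> h x - h y <= L * mdist (p x) (p y)) ->
  exists g : M -> R, (forall z w, `|g z - g w| <= L * mdist z w) /\
    forall x, X x -> g (p x) = h x.
Proof.
move=> L0 [x0 X0] hL.
pose S z := [set h x + L * mdist z (p x) | x in X].
have Slb z : has_lbound (S z).
  exists (h x0 - L * mdist z (p x0)) => _ [x Xx <-].
  have := hL _ _ X0 Xx.
  have := ler_wpM2l L0 (metric_triangle (p x0) z (p x)).
  by rewrite mulrDr (metric_sym (p x0) z); lra.
have S0 z : S z !=set0 by exists (h x0 + L * mdist z (p x0)), x0.
have gL z w : inf (S z) - inf (S w) <= L * mdist z w.
  rewrite lerBlDl -lerBlDr; apply: lb_le_inf => // _ [x Xx <-].
  rewrite lerBlDr -addrA -mulrDr.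
  apply: (@le_trans _ _ (h x + L * mdist z (p x))).
    by apply: ge_inf => //; exists x.
  by rewrite lerD2l ler_wpM2l// addrC; exact: metric_triangle.
exists (fun z => inf (S z)); split => [z w|x Xx].
  rewrite ler_norml gL andbT lerNl opprB.
  by rewrite metric_sym gL.
apply/eqP; rewrite eq_le; apply/andP; split.
  by apply: ge_inf => //; exists x => //; rewrite mdistxx mulr0 addr0.
apply: lb_le_inf => // _ [y Xy <-].
by have := hL _ _ Xx Xy; lra.
Qed.

(** With [D] the distance to [X], take the bumps [max 0 (D y - mdist x y)]. They act as a Kuratowski
    embedding of [M] with the closure of [X] collapsed to one point. *)
Lemma collapsing_family (R : realType) (M : metricType R) (X : set M) :
  X !=set0 -> exists phi : M -> M -> R,
  [/\ forall x y, X x -> phi x y = 0, forall x y, X y -> phi x y = 0,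
      forall x z y, `|phi x y - phi z y| <= mdist x z &
      forall x z, phi x =1 phi z -> x = z \/
        forall e, 0 < e -> (exists2 y, X y & mdist x y < e) /\
          exists2 y, X y & mdist z y < e].
Proof.
move=> X0.
pose D y := inf [set mdist y x | x in X].
have Dlb y : has_lbound [set mdist y x | x in X].
  by exists 0 => _ [x _ <-]; exact: mdist_ge0.
have DS y : [set mdist y x | x in X] !=set0.
  by have [x Xx] := X0; exists (mdist y x), x.
have D0 y : 0 <= D y by apply: lb_le_inf => // _ [x _ <-]; exact: mdist_ge0.
have DP y e : D y < e -> exists2 x, X x & mdist y x < e.
  move=> /inf_lt[//|_ [x Xx <-] xe].
  by exists x.
exists (fun x y => Num.max 0 (D y - mdist x y)); split.
- move=> x y Xx; apply/max_idPl; rewrite subr_le0 metric_sym.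
  by apply: ge_inf => //; exists x.
- move=> x y Xy; apply/max_idPl; rewrite subr_le0.
  rewrite (le_trans _ (mdist_ge0 x y))//.
  by apply: ge_inf => //; exists y => //; rewrite mdistxx.
- move=> x z y.
  have := metric_triangle x z y; have := metric_triangle z x y.
  rewrite (metric_sym z x) => xz zx; rewrite ler_norml.
  by case: (leP 0 (D y - mdist x y)); case: (leP 0 (D y - mdist z y)) => ? ?;
    apply/andP; split; lra.
- move=> x z; wlog xz : x z / D z <= D x => [H|].
    have [|/ltW] := leP (D z) (D x); first exact: H.
    move=> /H + xz; move=> /(_ (fsym xz))[->|xzE]; [by left|right => e e0].
    by have [] := xzE e e0.
  (* The bump centred at [x], the point farther from [X], has value [D x] at [x]; if [D x] is
     positive, it takes this value only there. *)
  move=> /(_ x); rewrite mdistxx subr0 (max_idPr (D0 x)) => DE.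
  have [x0|x0] := eqVneq (D x) 0.
    right => e e0; split; apply: DP; first by rewrite x0.
    by rewrite (le_lt_trans xz)// x0.
  left; apply: mdist_positivity; apply/eqP; rewrite eq_le mdist_ge0 andbT.
  have {}x0 : 0 < D x by rewrite lt_neqAle eq_sym x0 D0.
  rewrite metric_sym; have [v0|/ltW v0] := leP 0 (D x - mdist z x).
    by move: DE; rewrite (max_idPr v0); lra.
  by move: DE; rewrite (max_idPl v0); lra.
Qed.

(** Add [k] to every coordinate of the collapsing family. The bumps separate points unless both
    adhere to [X], where [k] separates them; on [X] the bumps vanish and only [k] contributes. *)
Lemma injective_lip0_dominated (R : realType) (M : pointedMetricType R)
    (X : set M) (k : M -> R) (L : R) : 0 <= L -> X !=set0 ->
  (forall x z, `|k x - k z| <= L * mdist x z) ->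
  (forall x z, (forall e, 0 < e -> exists2 y, X y & mdist x y < e) ->
     (forall e, 0 < e -> exists2 y, X y & mdist z y < e) ->
     k x = k z -> x = z) ->
  exists F : Lip0 M (bounded_map R M), injective F /\
    forall x z, X x -> X z -> mdist (F x) (F z) <= `|k x - k z|.
Proof.
move=> L0 X0 kL kinj.
have [phi [phiX phiX' phiL phi_inj]] := collapsing_family X0.
(* Subtracting the values at the base point sends it to 0 and makes each [F0 x] bounded in [y]. *)
pose F0 x y : R^o := phi x y - phi point y + (k x - k point).
have F0L x z y : `|F0 x y - F0 z y| <= (1 + L) * mdist x z.
  rewrite (_ : F0 x y - F0 z y = (phi x y - phi z y) + (k x - k z)); last first.
    by rewrite /F0; ring.
  by rewrite (le_trans (ler_normD _ _))// mulrDl mul1r lerD.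
have F0b x : F0 x \in bounded_map_pred R M.
  rewrite inE; exists ((1 + L) * mdist x point) => y.
  rewrite (_ : F0 x y = F0 x y - F0 point y) ?F0L//.
  by rewrite /F0; ring.
pose F x : bounded_map R M := BoundedMap (F0b x).
have FL : F \in lip0 M (bounded_map R M).
  rewrite inE; split.
    exists (1 + L); split; first by rewrite addr_ge0.
    move=> x z; apply: sup_dist_le; last exact: F0L.
    by rewrite mulr_ge0 ?addr_ge0// mdist_ge0.
  by apply/val_inj/funext => y /=; rewrite /F0 !subrr addr0.
exists (MkLip0 FL); split => [x z /(congr1 val)/= FE|x z Xx Xz].
  have {}FE y : F0 x y = F0 z y by rewrite FE.
  have [p Xp] := X0.
  have kE : k x = k z.
    by have := FE p; rewrite /F0 !(phiX' _ p)//; lra.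
  have phiE : phi x =1 phi z by move=> y; have := FE y; rewrite /F0 kE; lra.
  have [//|xzX] := phi_inj x z phiE.
  by apply: kinj => // e /xzX[].
apply: sup_dist_le => // y /=.
have -> // : F0 x y - F0 z y = k x - k z.
by rewrite /F0 (phiX x)// (phiX z)//; ring.
Qed.

(** * Elements of the free space, and the ends of a compact set *)

Lemma Free_delta_dist (R : realType) (M : pointedMetricType R) (x y : M) :
  `|Free_delta x - Free_delta y| <= mdist x y.
Proof.
apply: dual_norm_le => [|g]; first exact: mdist_ge0.
have [g0 _] := Lip0P g; have [_ gL] := best_lipschitz_constP g0.
by rewrite mulrC metric_sym; exact: gL.
Qed.

Lemma Free_valD (R : realType) (M : pointedMetricType R) (v w : Free M)
  (g : Lip0 M R^o) : Free_val (v + w) g = Free_val v g + Free_val w g.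
Proof. by []. Qed.

Lemma Free_valB (R : realType) (M : pointedMetricType R) (v w : Free M)
  (g : Lip0 M R^o) : Free_val (v - w) g = Free_val v g - Free_val w g.
Proof. by []. Qed.

Lemma gap_sum_Free (R : realType) (M : pointedMetricType R) (K : set R)
    (p : R -> M) (g : Lip0 M R^o) n c d :
  Free_val (gap_sum K (Free_delta \o p) n c d) g =
  gap_sum K (g \o p : R -> R) n c d.
Proof.
elim: n c d => [|n IH] c d; first exact: Free_valB.
rewrite [gap_sum _ _ n.+1 _ _]/= Free_valD !IH; reflexivity.
Qed.

(** The limit exists in the dual, and it stays in the closed span. *)
Lemma Free_cauchy_cvg (R : realType) (M : pointedMetricType R)
    (v : nat -> Free M) (e : nat -> R) :
  (forall m n, (m <= n)%N -> `|v m - v n| <= e m) ->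
  (forall d, 0 < d -> exists n, e n < d) ->
  exists w : Free M, forall n, `|v n - w| <= e n.
Proof.
move=> ve e0.
have [phi uphi] := @dual_cauchy_cvg R _ (fun n => Free_val (v n)) e ve e0.
suff phiF : phi \in closed_span (range (@delta R M)) by exists (MkFree phiF).
apply/closed_spanP => d d0; have d20 : 0 < d / 2 by rewrite divr_gt0.
have [n en] := e0 _ d20.
have /closed_spanP/(_ _ d20)[u uS un] := valP (v n).
exists u => //; rewrite (le_lt_trans (ler_distD (Free_val (v n)) _ _))//.
rewrite (splitr d) ltrD// distrC (le_lt_trans (uphi n))//.
Qed.

(** Take the least and greatest points of [K]: then []c, d]] misses only the null point [c] of
    [K]. *)
Lemma compact_ends (R : realType) (K : set R) : compact K ->
  (0 < lebesgue_measure K)%E -> exists c d : R,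
  [/\ K c, K d, c <= d & cdf K c < cdf K d].
Proof.
move=> cK K0.
have clK : closed K by apply: compact_closed => //; exact: Rhausdorff.
have mK := compact_measurable cK; have fK := compact_finite_measure cK.
have [k Kk] : K !=set0.
  by apply/set0P/eqP => K_0; move: K0; rewrite K_0 measure0 ltxx.
have /compact_bounded[B [_ /(_ (B + 1))]] := cK; rewrite ltrDl => /(_ ltr01) KB.
have inB x : K x -> - (B + 1) <= x <= B + 1 by move/KB; rewrite /= ler_norml.
have /andP[Bk kB] := inB k Kk.
have [Kc _ _ cP] := rpointP clK Kk Bk.
have [Kd _ _ dP] := lpointP clK Kk kB.
set c := rpoint _ _ in Kc cP; set d := lpoint _ _ in Kd dP.
have cE x : K x -> c <= x.
  by move=> Kx; apply: cP => //; have /andP[] := inB x Kx.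
have dE x : K x -> x <= d.
  by move=> Kx; apply: dP => //; have /andP[] := inB x Kx.
have cd := cE d Kd.
exists c, d; split => //; rewrite -subr_gt0 -lte_fin -cdfB//.
rewrite (lt_le_trans K0)//.
have mKI : measurable (K `&` `]c, d]) by exact: measurableI.
have := measureU2 lebesgue_measure (measurable_set1 c) mKI.
rewrite [X in (X + _)%E]lebesgue_measure_set1 add0e; apply: le_trans.
apply: le_measure; rewrite ?inE//; first exact: measurableU.
move=> x Kx; have [->|xc] := eqVneq x c; first by left.
by right; split => //=; rewrite in_itv/= lt_neqAle eq_sym xc cE//= dE.
Qed.

(** * A nonzero kernel element from a bi-Lipschitz piece of the line *)

Theorem corollary5p4 (R : realType) (M : completePointedMetricType R) :
  Lip_lin_injective M -> purely_1_unrectifiable M.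
Proof.
move=> LLI [A [f [A0 /bilipschitz_closure[p [a [b [a0 b0 pab]]]]]]].
have [K [cK KA Kq K0]] := positive_measure_compact A0.
have {}pab x y : K x -> K y ->
    a * `|x - y| <= mdist (p x) (p y) <= b * `|x - y|.
  by move=> /KA Ax /KA Ay; exact: pab.
have clK : closed K by apply: compact_closed => //; exact: Rhausdorff.
have mK := compact_measurable cK; have fK := compact_finite_measure cK.
have [c [d [Kc Kd cd cdf_cd]]] := compact_ends cK K0.
pose F x := x - cdf K x.
have F_mono x y : x <= y -> F x <= F y.
  by move=> xy; have := cdf_lip mK fK xy; rewrite /F; lra.
have F_lip x y : `|F x - F y| <= `|x - y|.
  wlog xy : x y / x <= y => [H|].
    have [|/ltW yx] := leP x y; first exact: H.
    by rewrite distrC [leRHS]distrC; exact: H.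
  rewrite distrC [leRHS]distrC !ger0_norm ?subr_ge0 ?F_mono//.
  by have := cdf_mono mK fK xy; rewrite /F; lra.
have F_inj x y : F x = F y -> x = y.
  wlog xy : x y / x <= y => [H|].
    have [|/ltW yx FE] := leP x y; first exact: H.
    exact/esym/H.
  move=> FE; move: xy; rewrite le_eqVlt => /orP[/eqP//|xy].
  by have := cdf_ltB mK fK xy clK Kq; move: FE; rewrite /F; lra.
pose s n := gap_sum K F n c d.
have s_ge0 n : 0 <= s n.
  rewrite -[leRHS]mul1r (le_trans (normr_ge0 (s n)))//.
  apply: gap_sum_norm => // x y Kx Ky xy; rewrite mul1r ger0_norm//.
  by rewrite subr_ge0; exact: F_mono.
have s_small r C : 0 <= C -> (forall n, r <= C * s n) -> r <= 0.
  move=> C0 rs; apply/ler_addgt0Pr => e e0; rewrite add0r.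
  have C1 : 0 < C + 1 by rewrite ltr_wpDl.
  have [n /(_ n (leqnn n)) ne] := gap_sum_cdf_cvg0 cK Kc Kd cd (divr_gt0 e0 C1).
  rewrite (le_trans (rs n))// (@le_trans _ _ ((C + 1) * s n))//.
    by rewrite ler_wpM2r// lerDl.
  by rewrite mulrC -ler_pdivlMr// ltW.
have idE n : gap_sum K id n c d = s n + (cdf K d - cdf K c).
  rewrite /s (gap_sumB K id (cdf K)).
  rewrite -[cdf K d - _](gap_sum_cst_gap (G := cdf K) clK n _ Kc Kd cd).
    by rewrite subrK.
  by move=> x y _ _ xy; exact: cdf_gap.
pose v n := gap_sum K (Free_delta \o p) n c d.
(* The distance from [v m] to [v n] is at most [b] times the length removed between the two stages,
   which is [s m - s n] by [idE]. *)
have [w vw] : exists w : Free M, forall n, `|v n - w| <= b * s n.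
  apply: Free_cauchy_cvg => [m n mn|e e0].
    apply: (@le_trans _ _ (b * (gap_sum K id m c d - gap_sum K id n c d))).
      apply: gap_sum_dist => // x y Kx Ky xy.
      rewrite (le_trans (Free_delta_dist _ _))//.
      by have /andP[_] := pab y x Ky Kx; rewrite ger0_norm ?subr_ge0.
    by rewrite ler_wpM2l// ?(ltW b0)// !idE; have := s_ge0 n; lra.
  have [n /(_ n (leqnn n)) ne] := gap_sum_cdf_cvg0 cK Kc Kd cd (divr_gt0 e0 b0).
  by exists n; rewrite mulrC -ltr_pdivlMr.
have vwg n (g : Lip0 M R^o) :
    `|gap_sum K (g \o p : R -> R) n c d - Free_val w g| <= b * `|g| * s n.
  rewrite -gap_sum_Free (le_trans (dual_normP (Free_val (v n - w)) g))//.
  by rewrite [leRHS]mulrAC ler_wpM2r//; exact: vw.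
have L0 : 0 <= a^-1 by rewrite invr_ge0 ltW.
have [k [kL kp]] : exists k : M -> R,
    (forall z y, `|k z - k y| <= a^-1 * mdist z y) /\
    forall x, K x -> k (p x) = x.
  apply: (@mcshane_extension _ _ R K p id) => //; first by exists c.
  move=> x y Kx Ky; have /andP[+ _] := pab _ _ Kx Ky.
  rewrite -ler_pdivlMl// => /(le_trans _); apply; exact: ler_norm.
have w0 : w != 0.
  have gL : (fun x => k x - k point : R^o) \in lip0 M R^o.
    rewrite inE; split; last by rewrite subrr.
    exists a^-1; split => // x y; rewrite metric_sym.
    rewrite -[leLHS]/(`|(k x - k point) - (k y - k point)|).
    have -> : (k x - k point) - (k y - k point) = k x - k y by ring.
    exact: kL.
  apply/negP => /eqP w_0; pose g := MkLip0 gL.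
  (* Pairing [v n] with [g] gives the total remaining length, never below [cdf K d - cdf K c]; if
     [w] were 0, it would be at most a multiple of [s n]. *)
  have : cdf K d - cdf K c <= 0.
    apply: (s_small _ (b * `|g|)); first by rewrite mulr_ge0// ltW.
    move=> n; have := vwg n g; rewrite w_0 subr0.
    rewrite (@eq_gap_sum _ _ clK _ _ id)//; last first.
      by move=> x y Kx Ky _; rewrite /= !kp//; ring.
    by move=> /(le_trans (ler_norm _)); rewrite idE; have := s_ge0 n; lra.
  by rewrite leNgt subr_gt0 cdf_cd.
have [Phi [Phi_inj PhiX]] : exists Phi : Lip0 M (bounded_map R M),
    injective Phi /\ forall x z, (p @` K) x -> (p @` K) z ->
      mdist (Phi x) (Phi z) <= `|F (k x) - F (k z)|.
  have kadh x : (forall e, 0 < e -> exists2 y, (p @` K) y & mdist x y < e) ->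
      x = p (k x).
    move=> xadh.
    have adh e : 0 < e ->
        exists y, [/\ K y, mdist x (p y) < e & `|k x - y| <= a^-1 * e].
      move=> /xadh[_ [y Ky <-] xy]; exists y; split => //.
      by rewrite -{1}(kp y Ky) (le_trans (kL _ _))// ler_wpM2l// ltW.
    have Kkx : K (k x).
      apply: clK => B /nbhs_ballP[e /= e0 eB].
      have e'0 : 0 < e * a / 2 by rewrite divr_gt0// mulr_gt0.
      have [y [Ky _ xy]] := adh _ e'0.
      exists y; split => //; apply: eB; rewrite /ball/= (le_lt_trans xy)//.
      have -> : a^-1 * (e * a / 2) = e / 2.
        by field; rewrite gt_eqF.
      by rewrite ltr_pdivrMr// ltr_pMr// ltr1n.
    apply: mdist_positivity; apply/eqP; rewrite eq_le mdist_ge0 andbT.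
    apply/ler_addgt0Pr => e e0; rewrite add0r.
    (* An error [d] from [x] to [p y] becomes [a^-1 * d] under [k], then [b * a^-1 * d] under
       [p]. *)
    have C0 : 0 < 1 + b * a^-1 by rewrite ltr_wpDr// mulr_ge0// ltW.
    have [y [Ky xy kxy]] := adh _ (divr_gt0 e0 C0).
    have /andP[_ pyk] := pab _ _ Ky Kkx.
    have kb : b * `|y - k x| <= b * (a^-1 * (e / (1 + b * a^-1))).
      by rewrite ler_wpM2l ?(ltW b0)// distrC.
    rewrite (le_trans (metric_triangle _ (p y) _))//.
    rewrite (le_trans (lerD (ltW xy) (le_trans pyk kb)))//.
    by rewrite mulrA -[X in X + _]mul1r -mulrDl mulrC divfK// gt_eqF.
  apply: (@injective_lip0_dominated _ _ _ (F \o k) a^-1) => //.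
  - by exists (p c), c.
  - by move=> x z /=; rewrite (le_trans (F_lip _ _)).
  - by move=> x z /kadh xE /kadh zE /F_inj /= kE; rewrite xE kE -zE.
have : linearization Phi w = 0.
  apply/val_inj/val_inj/funext => h /=.
  rewrite linearizationE; apply/eqP; rewrite -normr_le0.
  set hP := Lip0_comp Phi h.
  apply: (s_small _ (b * `|hP| + `|h|)).
    by rewrite addr_ge0// mulr_ge0// ltW.
  move=> n; rewrite mulrDl -(subKr (gap_sum K (hP \o p : R -> R) n c d) (w hP)).
  rewrite [leRHS]addrC (le_trans (ler_normB _ _))// lerD//.
    apply: gap_sum_norm => // x y Kx Ky xy.
    have [h0 _] := Lip0P h; have [_ hL] := best_lipschitz_constP h0.
    have PhiF : mdist (Phi (p x)) (Phi (p y)) <= F y - F x.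
      apply: (le_trans (PhiX _ _ _ _)); [by exists x|by exists y|].
      by rewrite !kp// distrC ger0_norm// subr_ge0; exact: F_mono.
    apply: le_trans (ler_wpM2l (normr_ge0 h) PhiF); exact: hL.
rewrite -(linear0 (linearization Phi)) => /(LLI _ _ Phi_inj)/eqP.
by rewrite (negbTE w0).
Qed.
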